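(* Let $f:\mathbb{R}\to\mathbb{R}$ be either monotone non-decreasing or continuous, with $f(0)=0$, and let $\mathcal{U}$ be a right (or left) Lebesgue-ultrafilter on $\mathbb{R}$. Then $\mu(u):=\mathcal{B}\lim_{\mathcal{U}}(f\circ u)$, $u\in L^\infty(\mathbb{R})$, defines a translation-invariant valuation on $L^\infty(\mathbb{R})$. Moreover, if $f$ is monotone non-decreasing (respectively, continuous), then $\mu$ is monotone (respectively, continuous).
   Context: $L^\infty(\mathbb{R})$ is the usual space of essentially bounded Lebesgue measurable functions $\mathbb{R}\to\mathbb{R}$ modulo almost everywhere equality, with the essential supremum norm $\|\cdot\|_\infty$. $B_\varepsilon(l)$ is the open interval $(l-\varepsilon,l+\varepsilon)$, and $A^\complement:=\mathbb{R}\setminus A$. A filter on $\mathbb{R}$ is a family $\mathcal{F}$ of subsets of $\mathbb{R}$ with $\mathbb{R}\in\mathcal{F}$, $\emptyset\notin\mathcal{F}$, closed under finite intersections and under supersets in $\mathbb{R}$. An ultrafilter is a filter $\mathcal{U}$ such that for all $A\subseteq\mathbb{R}$ either $A\in\mathcal{U}$ or $A^\complement\in\mathcal{U}$. An ultrafilter $\mathcal{U}$ is a Lebesgue-ultrafilter if $N^\complement\in\mathcal{U}$ for every Lebesgue-null set $N\subseteq\mathbb{R}$; it is a right (respectively, left) ultrafilter if $(a,\infty)\in\mathcal{U}$ (respectively, $(-\infty,a)\in\mathcal{U}$) for all $a\in\mathbb{R}$. For a Lebesgue-ultrafilter $\mathcal{U}$ and $v\in L^\infty(\mathbb{R})$,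 $\lim_{\mathcal{U}}v$ is the (unique, representative-independent) real number $l$ such that $\{x\in\mathbb{R}: v(x)\in B_\varepsilon(l)\}\in\mathcal{U}$ for all $\varepsilon>0$. The Cesàro-like average of a bounded measurable $u:\mathbb{R}\to\mathbb{R}$ is $\widehat{u}(0):=u(0)$ and $\widehat{u}(x):=\frac1x\int_0^x u(y)\,dy$ for $x\neq0$ (with $\int_a^b:=-\int_{[b,a]}$ if $b<a$); it induces an operator $\widehat{\cdot}:L^\infty(\mathbb{R})\to L^\infty(\mathbb{R})$. For $v\in L^\infty(\mathbb{R})$, $\mathcal{B}\lim_{\mathcal{U}}v:=\lim_{\mathcal{U}}\widehat{v}$. $u\lor v$, $u\land v$ are the pointwise maximum and minimum, $\mathbf{0}$ is the zero function. A valuation is a map $\mu:L^\infty(\mathbb{R})\to\mathbb{R}$ with $\mu(u\lor v)+\mu(u\land v)=\mu(u)+\mu(v)$ for all $u,v\in L^\infty(\mathbb{R})$ and $\mu(\mathbf{0})=0$. It is translation-invariant if $\mu(\mathcal{T}_tu)=\mu(u)$ for all $u\in L^\infty(\mathbb{R})$, $t\in\mathbb{R}$, where $\mathcal{T}_tu(x):=u(x-t)$; monotone if $u\le v$ almost everywhere implies $\mu(u)\le\mu(v)$; continuous if $\|u_n-u\|_\infty\to0$ implies $\mu(u_n)\to\mu(u)$. *)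

(* Defs.v *)
From HB Require Import structures.
From mathcomp Require Import all_boot all_order all_algebra.
From mathcomp Require Import all_classical all_reals all_analysis.
From mathcomp Require Import ess_sup_inf measurable_realfun.

From mathcomp Require Import lra.

Set Implicit Arguments.
Unset Strict Implicit.
Unset Printing Implicit Defensive.

Import Order.TTheory GRing.Theory Num.Def Num.Theory.
Import numFieldNormedType.Exports.

Local Open Scope classical_set_scope.
Local Open Scope ring_scope.

(* [lebT R] is the real line with the Lebesgue sigma-algebra (the sets that are
   Caratheodory measurable for the outer measure generated by interval length),
   as opposed to the Borel sets that [measurableTypeR R] carries. *)
Definition lebT (R : realType) : measurableType _ :=
  caratheodory_type ((@wlength R idfun)^*)%mu.

Definition leb (R : realType) : {measure set (lebT R) -> \bar R} :=
  @completed_lebesgue_measure R.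

Definition Linfty (R : realType) : Type := LspaceType (leb R) (leey 1%E).

Section Linfty_basics.
Variable R : realType.
Implicit Types (u v : Linfty R) (f g : R -> R).

Definition Linfty_fun u : R -> R := u.

Lemma leb_itv_oc (a b : R) : a <= b -> leb R `]a, b]%classic = (b - a)%:E.
Proof.
move=> ab; have -> : leb R `]a, b]%classic = lebesgue_measure `]a, b]%classic by [].
rewrite lebesgue_measure_itv/= lte_fin -EFinB.
by move: ab; rewrite le_eqVlt => /predU1P[->|->//]; rewrite ltxx subrr.
Qed.

Lemma measurable_lebT (A : set R) : measurable A -> measurable (A : set (lebT R)).
Proof. by move=> mA; apply: sub_caratheodory. Qed.

Lemma leb_setT_gt0 : (0 < leb R setT)%E.
Proof.
apply: (@lt_le_trans _ _ (leb R `]0, 1]%classic)).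
  by rewrite leb_itv_oc// subr0 lte01.
apply: le_measure; rewrite ?inE//; apply: measurable_lebT.
exact: measurable_itv.
Qed.

Lemma leb_aeS (P Q : R -> Prop) : (forall x, P x -> Q x) ->
  (\forall x \ae leb R, P x) -> \forall x \ae leb R, Q x.
Proof. exact: (@filterS _ _ (ae_filter_ringOfSetsType (leb R))). Qed.

Lemma leb_aeI (P Q : R -> Prop) :
  (\forall x \ae leb R, P x) -> (\forall x \ae leb R, Q x) ->
  \forall x \ae leb R, P x /\ Q x.
Proof. exact: (@filterI _ _ (ae_filter_ringOfSetsType (leb R))). Qed.

Lemma Lfun_bounded f : measurable_fun [set: lebT R] f ->
  (exists M : R, \forall x \ae leb R, `|f x| <= M) -> f \in Lfun (leb R) +oo%E.
Proof.
move=> mf [M fM]; rewrite inE; apply/andP; split; rewrite inE//=.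
rewrite /finite_norm unlock /Lnorm leb_setT_gt0.
apply: (@le_lt_trans _ _ M%:E); last exact: ltry.
by apply/ess_supP; apply: leb_aeS fM => x; rewrite /= lee_fin.
Qed.

(* The class modulo a.e. equality of an essentially bounded function. *)
Section class.
Variables (f : R -> R) (Lf : f \in Lfun (leb R) +oo%E).

Let mf : measurable_fun [set: lebT R] f.
Proof. by move: Lf; rewrite inE => /andP[]; rewrite inE. Qed.

Let fm : {mfun lebT R >-> measurableTypeR R} :=
  mfun_Sub (mem_set mf : (f : lebT R -> measurableTypeR R) \in mfun).

Let fq : {mfun_ leb R, lebT R >-> measurableTypeR R} :=
  (\pi_({mfun_ leb R, lebT R >-> measurableTypeR R}) fm)%qT.

Let fqE : fq = f %[ae leb R].
Proof.
have : (repr fq == fm %[mod {mfun_ leb R, lebT R >-> measurableTypeR R}])%qT.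
  by rewrite reprK.
by rewrite eqmodE// => /asboolP.
Qed.

Let fq_fin : finite_norm (leb R) +oo%E (fq : lebT R -> R).
Proof.
move: Lf; rewrite inE => /andP[_]; rewrite inE /= /finite_norm.
rewrite unlock /Lnorm leb_setT_gt0; apply: le_lt_trans.
apply: le_ess_sup; apply: leb_aeS fqE => x /(_ I) /= ->; exact: lexx.
Qed.

HB.instance Definition _ := isFinLebesgue.Build _ (lebT R) R (leb R) +oo%E
  (leey 1%E) fq fq_fin.

Definition Linfty_of : Linfty R := (fq : LspaceType (leb R) (leey 1%E)).

Lemma Linfty_ofE : \forall x \ae leb R, Linfty_fun Linfty_of x = f x.
Proof. by apply: leb_aeS fqE => x; apply. Qed.

End class.

Lemma Linfty_measurable u : measurable_fun [set: lebT R] (Linfty_fun u).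
Proof.
exact: (@measurable_funPT _ _ _ _
  (repr (u : {mfun_ leb R, lebT R >-> measurableTypeR R})%qT)).
Qed.

Lemma Linfty_bounded u :
  exists2 M : R, 0 <= M & \forall x \ae leb R, `|Linfty_fun u x| <= M.
Proof.
have : finite_norm (leb R) +oo%E (Linfty_fun u) by case: u => v [[]].
rewrite /finite_norm unlock /Lnorm leb_setT_gt0 => uoo.
have := @ess_sup_ge _ _ _ (leb R) (abse \o (EFin \o Linfty_fun u)).
move: (ess_sup _ _) uoo => [r _ |//|_].
- move=> h; exists `|r|; first exact: normr_ge0.
  by apply: leb_aeS h => x; rewrite /= lee_fin => /le_trans; apply; exact: ler_norm.
- by move=> h; exists 0 => //; apply: leb_aeS h => x /=; rewrite leNgt ltNyr.
Qed.

Lemma Linfty_eqP u v :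
  u = v <-> \forall x \ae leb R, Linfty_fun u x = Linfty_fun v x.
Proof.
split=> [->|uv]; first by apply: (@leb_aeS (fun=> True)) => //; exact: nearW.
case: u v uv => f [[ff]] [g [[gf]]] /= uv.
have fg : f = g.
  rewrite -[f]reprK -[g]reprK; apply/eqP; rewrite eqmodE; apply/asboolP.
  by apply: leb_aeS uv => x uvx _.
by case: _ / fg gf {uv} => gf; rewrite (Prop_irrelevance ff gf).
Qed.

End Linfty_basics.

Coercion Linfty_fun : Linfty >-> Funclass.

Section translation.
Variable R : realType.
Implicit Types (A : set R) (t : R).

Let leb_shift_le A t :
  (leb R ((fun x => (x - t)%R) @^-1` A)%classic <= leb R A)%E.
Proof.
apply/ereal_infP => _ [B [mB AB] <-].
apply: ereal_inf_lbound.
pose B' k : set R := (fun x => x - t) @^-1` (B k).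
exists B'.
  split=> [k|x /= /AB [k _ Bk]]; last by exists k.
  have [[a b] _ /= Bk] := mB k; exists (a + t, b + t) => //=.
  rewrite /B' -Bk; apply/seteqP; split=> x /=;
  by rewrite !in_itv/= ltrBrDr lerBlDr.
apply: eq_eseriesr => k _; have [[a b] _ /= Bk] := mB k.
have -> : B' k = `]a + t, b + t]%classic.
  rewrite /B' -Bk; apply/seteqP; split=> x /=;
  by rewrite !in_itv/= ltrBrDr lerBlDr.
by rewrite -Bk !wlength_itv/= !lte_fin ltrD2r -!EFinB opprD addrACA subrr addr0.
Qed.

Lemma leb_shift A t : leb R ((fun x => x - t) @^-1` A) = leb R A.
Proof.
apply/eqP; rewrite eq_le leb_shift_le/=.
have {1}-> : A = (fun x => x - (- t)) @^-1` ((fun x => x - t) @^-1` A).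
  by apply/seteqP; split=> x /=; rewrite opprK addrK.
exact: leb_shift_le.
Qed.

Let measurable_lebTE A : measurable (A : set (lebT R)) =
  forall X : set R, (leb R X = leb R (X `&` A) + leb R (X `&` ~` A))%E.
Proof. by []. Qed.

Lemma measurable_lebT_shift (A : set R) t : measurable (A : set (lebT R)) ->
  measurable ((fun x : R => x - t) @^-1` A : set (lebT R)).
Proof.
rewrite !measurable_lebTE => mA X.
rewrite -(leb_shift X (- t)) mA -[X in (X + _)%E = _](leb_shift _ t).
rewrite -[X in (_ + X)%E = _](leb_shift _ t).
by congr (leb R _ + leb R _)%E;
  apply/seteqP; split=> x /=; rewrite opprK subrK.
Qed.

Lemma leb_ae_shift (P : R -> Prop) t :
  (\forall x \ae leb R, P x) -> \forall x \ae leb R, P (x - t).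
Proof.
move=> [N [mN N0 PN]]; exists ((fun x : R => x - t) @^-1` N); split.
- exact: measurable_lebT_shift.
- by rewrite -[LHS]/(leb R _) leb_shift.
- by move=> x /= Px; apply: PN.
Qed.

End translation.

Section operations.
Variable R : realType.
Implicit Types (u v : Linfty R) (t : R).

Lemma Lfun_cst0 : (cst 0 : R -> R) \in Lfun (leb R) +oo%E.
Proof.
by apply: Lfun_bounded => //; exists 0; apply: nearW => x; rewrite normr0.
Qed.

Definition Linfty_zero : Linfty R := Linfty_of Lfun_cst0.

Lemma Lfun_max u v : (u \max v : R -> R) \in Lfun (leb R) +oo%E.
Proof.
apply: Lfun_bounded; first by apply: measurable_maxr; exact: Linfty_measurable.
have [M _ uM] := Linfty_bounded u; have [N _ vN] := Linfty_bounded v.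
exists (Num.max M N); apply: leb_aeS (leb_aeI uM vN) => x [uMx vNx] /=.
by rewrite le_max /Order.max; case: ifP => _; rewrite ?uMx ?vNx ?orbT.
Qed.

Definition Linfty_max u v : Linfty R := Linfty_of (Lfun_max u v).

Lemma Lfun_min u v : (u \min v : R -> R) \in Lfun (leb R) +oo%E.
Proof.
apply: Lfun_bounded; first by apply: measurable_minr; exact: Linfty_measurable.
have [M _ uM] := Linfty_bounded u; have [N _ vN] := Linfty_bounded v.
exists (Num.max M N); apply: leb_aeS (leb_aeI uM vN) => x [uMx vNx] /=.
by rewrite le_max /Order.min; case: ifP => _; rewrite ?uMx ?vNx ?orbT.
Qed.

Definition Linfty_min u v : Linfty R := Linfty_of (Lfun_min u v).

Lemma Lfun_translate t u : (fun x => u (x - t)) \in Lfun (leb R) +oo%E.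
Proof.
apply: Lfun_bounded.
  move=> _ Y mY; rewrite setTI.
  apply: (@measurable_lebT_shift _ ((u : R -> R) @^-1` Y)).
  by rewrite -[X in measurable X]setTI; exact: Linfty_measurable.
have [M _ uM] := Linfty_bounded u.
by exists M; exact: (@leb_ae_shift _ (fun x => `|u x| <= M)).
Qed.

Definition Linfty_translate t u : Linfty R := Linfty_of (Lfun_translate t u).

Lemma measurable_fun_lebT (f : R -> R) :
  measurable_fun [set: R] f -> measurable_fun [set: lebT R] f.
Proof.
move=> mf _ Y mY; rewrite setTI; apply: measurable_lebT.
by rewrite -[_ @^-1` _]setTI; exact: mf.
Qed.

Lemma Lfun_comp (f : R -> R) u : {homo f : x y / x <= y} \/ continuous f ->
  f \o u \in Lfun (leb R) +oo%E.
Proof.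
move=> hf.
have mf : measurable_fun [set: R] f.
  case: hf; first exact: nondecreasing_measurable.
  exact: continuous_measurable_fun.
have [M M0 uM] := Linfty_bounded u.
apply: Lfun_bounded.
  by apply: (measurableT_comp mf); exact: Linfty_measurable.
suff [K fK] : exists K, forall y, `|y| <= M -> `|f y| <= K.
  by exists K; apply: leb_aeS uM => x /fK.
case: hf => [ndf|cf].
- exists (`|f (- M)| + `|f M|) => y; rewrite ler_norml => /andP[/ndf fy1 /ndf fy2].
  rewrite ler_norml; apply/andP; split.
  + apply: le_trans fy1; rewrite (@le_trans _ _ (- `|f (- M)|))//.
      by rewrite opprD gerDl oppr_le0.
    exact: lerNnormlW.
  + by rewrite (le_trans fy2)// (le_trans (ler_norm _))// lerDr.
- have /compact_bounded[K [_ KP]] : compact (f @` `[- M, M]).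
    apply: continuous_compact; last exact: segment_compact.
    exact: continuous_subspaceT.
  exists (K + 1) => y yM; apply: (KP (K + 1)); first by rewrite ltrDl.
  by exists y => //=; rewrite in_itv/= -ler_norml.
Qed.

(* The hypothesis on [f] is only used to show that [f \o u] is measurable and
   essentially bounded. *)
Definition Linfty_comp (f : R -> R)
    (hf : {homo f : x y / x <= y} \/ continuous f) u : Linfty R :=
  Linfty_of (Lfun_comp u hf).

End operations.

Section cesaro.
Variable R : realType.
Implicit Types (u v : R -> R) (a b x : R).

Definition oriented_integral u a b : R :=
  if a <= b then \int[leb R]_(y in `[a, b]) u y
  else - \int[leb R]_(y in `[b, a]) u y.

Definition cesaro u x : R :=
  if x == 0 then u 0 else x^-1 * oriented_integral u 0 x.

Definition ae_bounded_by u M := 0 <= M /\ \forall x \ae leb R, `|u x| <= M.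

Lemma measurable_lebT_itv (i : interval R) : measurable ([set` i] : set (lebT R)).
Proof. by apply: measurable_lebT; exact: measurable_itv. Qed.

Lemma leb_itv_cc a b : a <= b -> leb R `[a, b]%classic = (b - a)%:E.
Proof.
move=> ab; have -> : leb R `[a, b]%classic = lebesgue_measure `[a, b]%classic by [].
rewrite lebesgue_measure_itv/= lte_fin -EFinB.
by move: ab; rewrite le_eqVlt => /predU1P[->|->//]; rewrite ltxx subrr.
Qed.

Lemma leb_integral_norm_le u M a b : measurable_fun [set: lebT R] u -> ae_bounded_by u M ->
  a <= b -> (\int[leb R]_(y in `[a, b]) `|u y|%:E <= (M * (b - a))%:E)%E.
Proof.
move=> mu [M0 uM] ab.
apply: (@le_trans _ _ (\int[leb R]_(y in `[a, b]) M%:E)%E).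
  have mau : measurable_fun (`[a, b] : set (lebT R)) (fun x => `|u x|%:E).
    apply: measurable_funTS; apply/measurable_EFinP.
    exact: (measurableT_comp _ mu).
  apply: ae_ge0_le_integral => //.
  - exact: measurable_lebT_itv.
  - by apply: leb_aeS uM => x ux _; rewrite lee_fin.
by rewrite integral_cst ?leb_itv_cc//; exact: measurable_lebT_itv.
Qed.

Lemma leb_integrable_itv u M a b : measurable_fun [set: lebT R] u -> ae_bounded_by u M ->
  (leb R).-integrable `[a, b] (EFin \o u).
Proof.
move=> mu uM; apply/integrableP; split.
  by apply: measurable_funTS; exact/measurable_EFinP.
have [ab|ba] := leP a b.
  by apply: (le_lt_trans (leb_integral_norm_le mu uM ab)); exact: ltry.
by rewrite set_itv_ge ?integral_set0// bnd_simp -ltNge.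
Qed.

Lemma leb_Rintegral_le u M a b : measurable_fun [set: lebT R] u -> ae_bounded_by u M ->
  a <= b -> `|\int[leb R]_(y in `[a, b]) u y| <= M * (b - a).
Proof.
move=> mu uM ab.
rewrite -lee_fin EFin_normr_Rintegral; first last.
  - exact: leb_integrable_itv uM.
  - exact: measurable_lebT_itv.
apply: (le_trans _ (leb_integral_norm_le mu uM ab)).
apply: le_abse_integral; first exact: measurable_lebT_itv.
by apply: measurable_funTS; exact/measurable_EFinP.
Qed.

Lemma leb_Rintegral_subset u M a b c d : measurable_fun [set: lebT R] u ->
  ae_bounded_by u M -> (forall x, 0 <= u x) -> `[a, b] `<=` `[c, d] ->
  \int[leb R]_(y in `[a, b]) u y <= \int[leb R]_(y in `[c, d]) u y.
Proof.
move=> mu uM u0 abcd.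
rewrite /Rintegral fine_le//.
- by apply: integrable_fin_num; [exact: measurable_lebT_itv|exact: leb_integrable_itv uM].
- by apply: integrable_fin_num; [exact: measurable_lebT_itv|exact: leb_integrable_itv uM].
- apply: ge0_subset_integral.
  + exact: measurable_lebT_itv.
  + exact: measurable_lebT_itv.
  + by apply: measurable_funTS; exact/measurable_EFinP.
  + by move=> x _; rewrite lee_fin.
  + exact: abcd.
Qed.

Lemma leb_measurable_oint_ge0 u M : measurable_fun [set: lebT R] u ->
  ae_bounded_by u M -> (forall x, 0 <= u x) ->
  measurable_fun [set: R] (oriented_integral u 0).
Proof.
move=> mu uM u0; apply: measurable_fun_ifT.
- by apply: measurable_fun_ler.
- apply: nondecreasing_measurable => // x y xy.
  apply: leb_Rintegral_subset mu uM u0 _ => z /=; rewrite !in_itv/= => /andP[-> zx].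
  exact: le_trans zx xy.
- apply: nondecreasing_measurable => // x y xy; rewrite lerN2.
  apply: leb_Rintegral_subset mu uM u0 _ => z /=; rewrite !in_itv/= => /andP[yz ->].
  by rewrite (le_trans xy yz).
Qed.

Lemma leb_measurable_oint u M : measurable_fun [set: lebT R] u ->
  ae_bounded_by u M -> measurable_fun [set: R] (oriented_integral u 0).
Proof.
move=> mu uM.
pose p x := Num.max (u x) 0; pose n x := Num.max (- u x) 0.
have mp : measurable_fun [set: lebT R] p by apply: measurable_maxr mu _; exact: measurable_cst.
have mn : measurable_fun [set: lebT R] n.
  apply: measurable_maxr; last exact: measurable_cst.
  exact: (measurableT_comp _ mu).
have pM : ae_bounded_by p M.
  split; first by case: uM.
  have [M0 uM'] := uM; apply: leb_aeS uM' => x ux; rewrite /p.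
  by case: (ltP (u x) 0) => _; rewrite ?normr0.
have nM : ae_bounded_by n M.
  split; first by case: uM.
  have [M0 uM'] := uM; apply: leb_aeS uM' => x ux; rewrite /n.
  by case: (ltP (- u x) 0) => _; rewrite ?normr0 ?normrN.
have upn x : u x = p x - n x.
  by rewrite /p /n; case: (ltP (u x) 0) => ux; case: (ltP (- u x) 0) => uy; lra.
have -> : oriented_integral u 0 =
    (fun x => oriented_integral p 0 x - oriented_integral n 0 x).
  apply/funext => x; rewrite /oriented_integral.
  have E a b : \int[leb R]_(y in `[a, b]) u y =
      \int[leb R]_(y in `[a, b]) p y - \int[leb R]_(y in `[a, b]) n y.
    rewrite -RintegralB; [|exact: measurable_lebT_itv|exact: leb_integrable_itv pM|exact: leb_integrable_itv nM].
    by apply: eq_Rintegral => y _.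
  by case: ifP => _; rewrite E// opprB opprK addrC.
apply: measurable_funB.
- apply: (leb_measurable_oint_ge0 mp pM) => x; by rewrite /p le_max lexx orbT.
- apply: (leb_measurable_oint_ge0 mn nM) => x; by rewrite /n le_max lexx orbT.
Qed.

Lemma Lfun_cesaro (u : Linfty R) : cesaro u \in Lfun (leb R) +oo%E.
Proof.
have [M M0 uM] := Linfty_bounded u.
have mu := Linfty_measurable u.
apply: Lfun_bounded.
  apply: measurable_fun_lebT; apply: measurable_fun_if => //.
  - exact: measurable_fun_eqr.
  - rewrite setTI; apply: measurable_funM; last first.
      exact: measurable_funTS (leb_measurable_oint mu (conj M0 uM)).
    have -> : (fun x : R => x == 0) @^-1` [set false] = [set~ 0].
      by apply/seteqP; split=> x /=; [move/eqP|move/eqP/negbTE].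
    apply: open_continuous_measurable_fun.
      by rewrite openC; exact: closed_eq.
    by move=> x; rewrite inE/= => /eqP x0; exact: inv_continuous.
exists (`|u 0| + M); apply: nearW => x; rewrite /cesaro.
have [_|x0] := eqVneq; first by rewrite lerDl.
apply: (@le_trans _ _ M); last by rewrite lerDr.
rewrite normrM normfV mulrC ler_pdivrMr ?normr_gt0// /oriented_integral.
case: (leP 0 x) => x0'.
  by rewrite (le_trans (leb_Rintegral_le mu (conj M0 uM) x0'))// subr0 ger0_norm.
rewrite normrN (le_trans (leb_Rintegral_le mu (conj M0 uM) (ltW x0')))//.
by rewrite sub0r ltr0_norm.
Qed.

Definition Linfty_cesaro (u : Linfty R) : Linfty R := Linfty_of (Lfun_cesaro u).

Lemma cesaro_ae u v x : measurable_fun [set: lebT R] u ->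
  measurable_fun [set: lebT R] v -> (\forall y \ae leb R, u y = v y) ->
  x != 0 -> cesaro u x = cesaro v x.
Proof.
move=> mu mv uv /negbTE x0; rewrite /cesaro x0; congr (_ * _).
have E a b : \int[leb R]_(y in `[a, b]) u y = \int[leb R]_(y in `[a, b]) v y.
  congr fine; apply: ae_eq_integral.
  - exact: measurable_lebT_itv.
  - by apply: measurable_funTS; exact/measurable_EFinP.
  - by apply: measurable_funTS; exact/measurable_EFinP.
  - by apply: leb_aeS uv => y ->.
by rewrite /oriented_integral !E.
Qed.

Lemma Linfty_cesaroE (u : Linfty R) v : measurable_fun [set: lebT R] v ->
  (\forall x \ae leb R, u x = v x) ->
  \forall x \ae leb R, Linfty_cesaro u x = cesaro v x.
Proof.
move=> mv uv.
have n0 : \forall x \ae leb R, x != 0 :> R.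
  exists ([set 0] : set R); split.
  - by apply: (@measurable_lebT _ [set 0]); exact: measurable_set1.
  - by rewrite -[LHS]/(lebesgue_measure [set 0]) lebesgue_measure_set1.
  - by move=> x /= /negP; rewrite negbK => /eqP.
apply: leb_aeS (leb_aeI n0 (Linfty_ofE (Lfun_cesaro u))) => x [x0 ->].
exact: cesaro_ae (Linfty_measurable u) mv uv x0.
Qed.

End cesaro.

Section ultrafilters.
Variable R : realType.

Definition lebesgue_ultrafilter (U : set_system R) :=
  UltraFilter U /\ forall N : set R, (leb R).-negligible N -> U (~` N).

Definition right_filter (U : set_system R) := forall a : R, U `]a, +oo[%classic.
Definition left_filter (U : set_system R) := forall a : R, U `]-oo, a[%classic.

(* [lim] is a total function; [ulimP] shows that the limit exists and does not
   depend on the representative. *)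
Definition ulim (U : set_system R) (v : Linfty R) : R := lim (v @ U).

Definition Bulim (U : set_system R) (v : Linfty R) : R :=
  ulim U (Linfty_cesaro v).

Lemma ulimP (U : set_system R) (v : Linfty R) (g : R -> R) :
  lebesgue_ultrafilter U -> (\forall x \ae leb R, v x = g x) ->
  g @ U --> ulim U v.
Proof.
move=> [UU NU] vg.
have aeU (P : R -> Prop) : (\forall x \ae leb R, P x) -> U [set x | P x].
  by move=> /NU; rewrite setCK.
have [M M0 vM] := Linfty_bounded v.
have [p [_ vp]] : `[- M, M]%classic `&` cluster (v @ U) !=set0.
  have vU : U (v @^-1` `[- M, M]%classic).
    apply: filterS (aeU (fun x => `|v x| <= M) vM) => x /=.
    by rewrite in_itv/= -ler_norml.
  exact: (@segment_compact R (- M) M (v @ U) _ vU).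
have vUp : v @ U --> p.
  move=> N Np; have [//|VN] := in_ultra_setVsetC (v @^-1` N) UU.
  by have [y []] := vp (~` N) N VN Np.
rewrite /ulim (cvg_lim _ vUp)//.
move=> N /vUp vN.
suff : U (g @^-1` N) by [].
apply: filterS (filterI (vN : U (v @^-1` N)) (aeU (fun x => v x = g x) vg)).
by move=> x [/= + <-].
Qed.

End ultrafilters.

Section valuations.
Variable R : realType.
Implicit Types (m : Linfty R -> R) (u v : Linfty R).

Definition Linfty_valuation m :=
  (forall u v, m (Linfty_max u v) + m (Linfty_min u v) = m u + m v) /\
  m (Linfty_zero R) = 0.

Definition Linfty_translation_invariant m :=
  forall t u, m (Linfty_translate t u) = m u.

Definition Linfty_monotone m :=
  forall u v, (\forall x \ae leb R, u x <= v x) -> m u <= m v.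

Definition Linfty_continuous m := forall (w : nat -> Linfty R) u,
  'N[leb R]_+oo[EFin \o (w n \- u)%R]%E @[n --> \oo] --> 0%E ->
  m (w n) @[n --> \oo] --> m u.

End valuations.

(* Main.v *)
(* Since f(u \/ v) - f(u) = f(v) - f(u /\ v) pointwise, linearity of the Cesaro
   average gives the valuation identity. Translating u by t changes its average
   at x by at most 2 ||u|| |t| / |x|, which vanishes at infinity, where the
   ultrafilter lives. Monotonicity and 1-Lipschitz continuity pass from the
   average to the ultralimit; a continuous f is uniformly continuous on the
   essential range of u, so f o w_n tends to f o u uniformly almost
   everywhere. *)
Require Import Defs.
From HB Require Import structures.
From mathcomp Require Import all_boot all_order all_algebra.
From mathcomp Require Import all_classical all_reals all_analysis.
From mathcomp Require Import ess_sup_inf measurable_realfun lra.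
Set Implicit Arguments.
Unset Strict Implicit.

Import Order.TTheory GRing.Theory Num.Theory.
Import numFieldNormedType.Exports.
Local Open Scope classical_set_scope.
Local Open Scope ring_scope.

Local Notation cesaro := Defs.cesaro.

(** * Oriented integrals: additivity, bounds and translation *)

Section oriented_integral.
Variables (R : realType) (u : R -> R) (M : R).
Hypotheses (mu : measurable_fun [set: lebT R] u) (uM : ae_bounded_by u M).

Lemma Rintegral_leb_itv_split (a b c : R) : a <= b -> b <= c ->
  \int[leb R]_(y in `[a, c]) u y =
  \int[leb R]_(y in `[a, b]) u y + \int[leb R]_(y in `[b, c]) u y.
Proof.
move=> ab bc.
have mset1 : measurable ([set b] : set (lebT R)).
  by apply: measurable_lebT; exact: measurable_set1.
have moc : measurable (`]b, c]%classic : set (lebT R)).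
  exact: measurable_lebT_itv.
(* The two closed segments share the null point [b]; dropping it from the second makes the union
   disjoint. *)
have -> : \int[leb R]_(y in `[b, c]) u y = \int[leb R]_(y in `]b, c]) u y.
  have E : `[b, c]%classic = [set b] `|` `]b, c]%classic by rewrite setU1itv.
  rewrite E Rintegral_setU//.
  - rewrite [X in X + _](_ : _ = 0) ?add0r//; rewrite /Rintegral.
    rewrite (null_set_integral mset1)//.
    + by apply: measurable_funTS; exact/measurable_EFinP.
    + by rewrite -[LHS]/(lebesgue_measure [set b]) lebesgue_measure_set1.
  - by rewrite -E; exact: leb_integrable_itv uM.
  - by apply/disj_setPS => x [/= ->]; rewrite in_itv/= ltxx.
have E : `[a, c]%classic = `[a, b]%classic `|` `]b, c]%classic.
  by rewrite -itv_bndbnd_setU// bnd_simp.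
rewrite E Rintegral_setU//; first exact: measurable_lebT_itv.
- by rewrite -E; exact: leb_integrable_itv uM.
- by apply/disj_setPS => x [/=]; rewrite !in_itv/= => /andP[_ xb] /andP[/lt_geF]; rewrite xb.
Qed.

Lemma oriented_integral_chasles (a b c : R) :
  oriented_integral u a b + oriented_integral u b c = oriented_integral u a c.
Proof.
have s := Rintegral_leb_itv_split; rewrite /oriented_integral.
have z x y : x <= y -> y <= x -> \int[leb R]_(t in `[x, y]) u t = 0.
  move=> xy yx; have E : x = y by apply: le_anti; rewrite xy yx.
  have := s x x x (lexx _) (lexx _); rewrite -E; lra.
(* Two of the eight cases are contradictory; each of the others is one split at the middle point. *)
case: (leP a b) => ab; case: (leP b c) => bc; case: (leP a c) => ac.
- by rewrite (s a b c).
- by move: (le_trans ab bc); rewrite leNgt ac.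
- by rewrite (s a c b)// ?addrK// ltW.
- by rewrite (s c a b) ?(ltW ac)//; lra.
- by rewrite (s b a c) ?(ltW ab)//; lra.
- by rewrite (s b c a) ?(ltW ac)//; lra.
- by move: (lt_le_trans bc (le_trans (ltW ab) ac)); rewrite ltxx.
- by rewrite (s c b a) ?(ltW bc) ?(ltW ab)//; lra.
Qed.

Lemma oriented_integral_norm_le (a b : R) :
  `|oriented_integral u a b| <= M * `|b - a|.
Proof.
rewrite /oriented_integral; case: (leP a b) => ab.
  rewrite (le_trans (leb_Rintegral_le mu uM ab))//.
  by rewrite ger0_norm ?subr_ge0.
rewrite normrN (le_trans (leb_Rintegral_le mu uM (ltW ab)))//.
by rewrite ltr0_norm ?subr_lt0// opprB.
Qed.

Lemma measurable_fun_leb_shift (t : R) :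
  measurable_fun [set: lebT R] (fun x : R => u (x - t)).
Proof.
move=> _ Y mY; rewrite setTI.
apply: (@measurable_lebT_shift _ (u @^-1` Y)).
by rewrite -[X in measurable X]setTI; exact: mu.
Qed.

Lemma ae_bounded_by_shift (t : R) : ae_bounded_by (fun x => u (x - t)) M.
Proof.
case: uM => M0 uM'; split=> //.
exact: (@leb_ae_shift _ (fun x => `|u x| <= M)).
Qed.

(** Since [leb] is translation invariant, it equals its pushforward under [phi], so this is a change
    of variables along [phi]. *)
Lemma Rintegral_leb_shift (t a b : R) :
  \int[leb R]_(y in `[a, b]) u (y - t) =
  \int[leb R]_(y in `[a - t, b - t]) u y.
Proof.
pose phi : lebT R -> lebT R := fun x : R => x - t.
have mphi : measurable_fun [set: lebT R] phi.
  by move=> _ Y mY; rewrite setTI; exact: measurable_lebT_shift.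
have phiab : phi @^-1` `[a - t, b - t] = `[a, b]%classic.
  by apply/seteqP; split=> x /=; rewrite !in_itv/= !lerD2r.
rewrite /Rintegral; congr fine.
rewrite -[RHS](@eq_measure_integral _ _ _ _ (leb R) (pushforward (leb R) phi)).
  rewrite [RHS](integral_pushforward mphi) ?phiab//.
  - exact/measurable_EFinP.
  - exact: (leb_integrable_itv _ _ (measurable_fun_leb_shift t) (ae_bounded_by_shift t)).
  - exact: measurable_lebT_itv.
by move=> A _ _; exact: leb_shift.
Qed.

Lemma oriented_integral_shift (t a b : R) :
  oriented_integral (fun y => u (y - t)) a b =
  oriented_integral u (a - t) (b - t).
Proof. by rewrite /oriented_integral !Rintegral_leb_shift lerD2r. Qed.

End oriented_integral.

(** * Pointwise estimates for the Cesàro average *)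

Section cesaro.
Variable R : realType.
Implicit Types (u v : R -> R) (M N t x : R).

Lemma ae_bounded_byB u v M N : ae_bounded_by u M -> ae_bounded_by v N ->
  ae_bounded_by (fun x => u x - v x) (M + N).
Proof.
move=> [M0 uM] [N0 vN]; split; first exact: addr_ge0.
apply: leb_aeS (leb_aeI uM vN) => x [ux vx].
by rewrite (le_trans (ler_normB _ _))// lerD.
Qed.

Lemma cesaro_norm_le u M x : measurable_fun [set: lebT R] u ->
  ae_bounded_by u M -> x != 0 -> `|cesaro u x| <= M.
Proof.
move=> mu uM x0; rewrite /cesaro (negbTE x0) normrM normfV mulrC.
rewrite ler_pdivrMr ?normr_gt0// -[X in _ * `|X|]subr0.
exact: oriented_integral_norm_le.
Qed.

Lemma cesaroB u v M N x : measurable_fun [set: lebT R] u ->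
  measurable_fun [set: lebT R] v -> ae_bounded_by u M -> ae_bounded_by v N ->
  cesaro (fun y => u y - v y) x = cesaro u x - cesaro v x.
Proof.
move=> mu mv uM vN; rewrite /cesaro; case: ifP => // _; rewrite -mulrBr.
congr (_ * _).
have E a b : \int[leb R]_(y in `[a, b]) (u y - v y) =
    \int[leb R]_(y in `[a, b]) u y - \int[leb R]_(y in `[a, b]) v y.
  rewrite RintegralB//; first exact: measurable_lebT_itv.
  - exact: leb_integrable_itv uM.
  - exact: leb_integrable_itv vN.
by rewrite /oriented_integral; case: ifP => _; rewrite E//; lra.
Qed.

Lemma cesaro_ge0 u x : measurable_fun [set: lebT R] u ->
  (\forall y \ae leb R, 0 <= u y) -> x != 0 -> 0 <= cesaro u x.
Proof.
move=> mu u0 x0.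
(* Passing to the absolute value turns almost everywhere nonnegativity into the pointwise one; away
   from 0 the average is unchanged. *)
have -> : cesaro u x = cesaro (fun y => `|u y|) x.
  apply: (cesaro_ae mu (measurableT_comp (@normr_measurable _ setT) mu) _ x0).
  by apply: leb_aeS u0 => y uy; rewrite /= ger0_norm.
rewrite /cesaro (negbTE x0) /oriented_integral; case: (leP 0 x) => xge0.
  by rewrite mulr_ge0 ?invr_ge0//; exact: Rintegral_ge0.
(* For negative [x] the sign of the oriented integral cancels that of [x^-1]. *)
rewrite mulrN -mulNr mulr_ge0// ?oppr_ge0 ?invr_le0 ?(ltW xge0)//.
exact: Rintegral_ge0.
Qed.

Lemma cesaro_le u v M N x : measurable_fun [set: lebT R] u ->
  measurable_fun [set: lebT R] v -> ae_bounded_by u M -> ae_bounded_by v N ->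
  (\forall y \ae leb R, u y <= v y) -> x != 0 -> cesaro u x <= cesaro v x.
Proof.
move=> mu mv uM vN uv x0; rewrite -subr_ge0 -(cesaroB x mv mu vN uM).
apply: (cesaro_ge0 (measurable_funB mv mu) _ x0).
by apply: leb_aeS uv => y; rewrite subr_ge0.
Qed.

(** The integrals over the segment and its translate differ by two end pieces of length [|t|], each
    contributing at most [M * |t|]. *)
Lemma cesaro_shift_dist u M t x : measurable_fun [set: lebT R] u ->
  ae_bounded_by u M -> x != 0 ->
  `|cesaro (fun y => u (y - t)) x - cesaro u x| <= 2 * M * `|t| / `|x|.
Proof.
move=> mu uM x0; rewrite /cesaro (negbTE x0) -mulrBr normrM normfV mulrC.
rewrite ler_pM2r ?invr_gt0 ?normr_gt0// (oriented_integral_shift mu uM) sub0r.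
have -> : oriented_integral u (- t) (x - t) - oriented_integral u 0 x =
    oriented_integral u (- t) 0 - oriented_integral u (x - t) x.
  have := oriented_integral_chasles mu uM (- t) 0 (x - t).
  have := oriented_integral_chasles mu uM 0 (x - t) x.
  lra.
have := oriented_integral_norm_le mu uM (- t) 0.
have := oriented_integral_norm_le mu uM (x - t) x.
rewrite sub0r opprK (_ : x - (x - t) = t) => [h1 h2|]; last by lra.
by rewrite (le_trans (ler_normB _ _))// (le_trans (lerD h2 h1))//; lra.
Qed.

End cesaro.

(** * Limits of Cesàro averages along a Lebesgue-ultrafilter *)

Section Bulim.
Variables (R : realType) (U : set_system R).
Hypothesis hU : lebesgue_ultrafilter U.
Implicit Types (u v : Linfty R) (g : R -> R) (K : R).

#[local] Instance lebesgue_ultrafilter_proper : ProperFilter U.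
Proof. by case: hU => -[]. Qed.

Lemma Linfty_ae_bounded_by u : exists M, ae_bounded_by u M.
Proof. by have [M M0 uM] := Linfty_bounded u; exists M. Qed.

(** At 0 the value of [cesaro] depends on the representative and escapes the estimates above; the
    ultrafilter discards this null point. *)
Lemma lebesgue_ultrafilter_neq0 : \forall x \near U, x != 0.
Proof.
have : (leb R).-negligible [set 0 : R].
  exists ([set 0] : set R); split=> //.
  - by apply: (@measurable_lebT _ [set 0]); exact: measurable_set1.
  - by rewrite -[LHS]/(lebesgue_measure [set 0]) lebesgue_measure_set1.
by case: hU => _ /[apply]; apply: filterS => x /eqP.
Qed.

(** Allows computing with an explicit function instead of the representative chosen by
    [Linfty_of]. *)
Lemma Bulim_cvg u g : measurable_fun [set: lebT R] g ->
  (\forall x \ae leb R, u x = g x) -> cesaro g @ U --> Bulim U u.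
Proof. by move=> mg ug; apply: ulimP => //; exact: Linfty_cesaroE. Qed.

Lemma Bulim_cvg_id u : cesaro u @ U --> Bulim U u.
Proof. by apply: Bulim_cvg; [exact: Linfty_measurable|exact: nearW]. Qed.

Lemma Bulim_cvgB u v :
  cesaro (fun y => u y - v y) @ U --> Bulim U u - Bulim U v.
Proof.
have [M uM] := Linfty_ae_bounded_by u; have [N vN] := Linfty_ae_bounded_by v.
have -> : cesaro (fun y => u y - v y) = (fun x => cesaro u x - cesaro v x).
  by apply/funext => x; exact: (cesaroB x (@Linfty_measurable R u) (@Linfty_measurable R v) uM vN).
by apply: cvgB; exact: Bulim_cvg_id.
Qed.

(** The valuation identity will be used in this form: differences that agree almost everywhere have
    the same averages away from 0, hence the same limit. *)
Lemma Bulim_subr u1 u2 v1 v2 :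
  (\forall x \ae leb R, u1 x - u2 x = v1 x - v2 x) ->
  Bulim U u1 - Bulim U u2 = Bulim U v1 - Bulim U v2.
Proof.
move=> uv; have mB u v : measurable_fun [set: lebT R] (fun y => u y - v y).
  by apply: measurable_funB; exact: Linfty_measurable.
rewrite -(cvg_lim (@norm_hausdorff _ R) (@Bulim_cvgB u1 u2)).
apply: cvg_lim; first exact: norm_hausdorff.
apply: cvg_trans (@Bulim_cvgB v1 v2); apply: near_eq_cvg.
apply: filterS lebesgue_ultrafilter_neq0 => x x0.
exact/esym/(cesaro_ae (mB _ _) (mB _ _) uv x0).
Qed.

Lemma Bulim_dist_le u v K : 0 <= K ->
  (\forall x \ae leb R, `|u x - v x| <= K) -> `|Bulim U u - Bulim U v| <= K.
Proof.
move=> K0 uvK; apply: (ler_cvg_to (cvg_norm (@Bulim_cvgB u v)) (cvg_cst K)).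
apply: filterS lebesgue_ultrafilter_neq0 => x x0.
apply: cesaro_norm_le x0; last by split.
by apply: measurable_funB; exact: Linfty_measurable.
Qed.

Lemma Bulim_le u v : (\forall x \ae leb R, u x <= v x) ->
  Bulim U u <= Bulim U v.
Proof.
move=> uv.
have [M uM] := Linfty_ae_bounded_by u; have [N vN] := Linfty_ae_bounded_by v.
apply: (ler_cvg_to (@Bulim_cvg_id u) (@Bulim_cvg_id v)).
apply: filterS lebesgue_ultrafilter_neq0 => x x0.
exact: (cesaro_le (@Linfty_measurable R u) (@Linfty_measurable R v) uM vN uv x0).
Qed.

Lemma Bulim_eq0 u : (\forall x \ae leb R, u x = 0) -> Bulim U u = 0.
Proof.
move=> u0; apply/eqP; rewrite -normr_le0.
apply: (ler_cvg_to (cvg_norm (@Bulim_cvg_id u)) (cvg_cst 0)).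
apply: filterS lebesgue_ultrafilter_neq0 => x x0.
apply: (cesaro_norm_le (@Linfty_measurable R u)) x0; split=> //.
by apply: leb_aeS u0 => y ->; rewrite normr0.
Qed.

(** Merges the right and left cases: in both, [1 / |x|] tends to 0 along [U]. *)
Lemma near_normr_gt K : right_filter U \/ left_filter U ->
  \forall x \near U, K < `|x|.
Proof.
case=> [/(_ K)|/(_ (- K))]; apply: filterS => x /=; rewrite in_itv/=.
- by rewrite andbT => /lt_le_trans; apply; exact: ler_norm.
- by rewrite ltrNr => /lt_le_trans; apply; rewrite -normrN; exact: ler_norm.
Qed.

Lemma Bulim_translate u (t : R) : right_filter U \/ left_filter U ->
  Bulim U (Linfty_translate t u) = Bulim U u.
Proof.
move=> Ulr; have [M uM] := Linfty_ae_bounded_by u; have [M0 _] := uM.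
have mu := @Linfty_measurable R u.
have cT := Bulim_cvg (@measurable_fun_leb_shift R u mu t)
  (Linfty_ofE (Lfun_translate t u)).
apply/eqP; rewrite -subr_eq0 -normr_le0; apply/ler_addgt0Pl => e e0; rewrite addr0.
apply: (ler_cvg_to (cvg_norm (cvgB cT (@Bulim_cvg_id u))) (cvg_cst e)).
(* Beyond this threshold the bound [2 * M * |t| / |x|] of [cesaro_shift_dist] is below [e]. *)
have := near_normr_gt (2 * M * `|t| / e) Ulr.
apply: filterS2 lebesgue_ultrafilter_neq0 => x x0 xK.
rewrite (le_trans (cesaro_shift_dist t mu uM x0))//.
by rewrite ler_pdivrMr ?normr_gt0// [e * _]mulrC ltW// -ltr_pdivrMr.
Qed.

End Bulim.

(** * Composition with [f], and uniform approximation *)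

Section composition.
Variables (R : realType) (f : R -> R).
Hypothesis hf : {homo f : x y / x <= y} \/ continuous f.

Lemma Linfty_comp_translate (t : R) (u : Linfty R) :
  Linfty_comp hf (Linfty_translate t u) = Linfty_translate t (Linfty_comp hf u).
Proof.
apply/Linfty_eqP.
have h1 := Linfty_ofE (Lfun_comp (Linfty_translate t u) hf).
have h2 := Linfty_ofE (Lfun_translate t u).
(* This equality is needed at [x - t], so its exceptional null set is translated. *)
have h3 := leb_ae_shift t (Linfty_ofE (Lfun_comp u hf)).
have h4 := Linfty_ofE (Lfun_translate t (Linfty_comp hf u)).
apply: leb_aeS (leb_aeI (leb_aeI h1 h2) (leb_aeI h3 h4)) => x [[e1 e2] [e3 e4]].
by rewrite [LHS]e1 [RHS]e4 [RHS]e3 /= [in LHS]e2.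
Qed.

End composition.

(* Heine-Cantor on [[-M, M]], with [y] allowed to leave the segment. *)
Lemma continuous_segment_unif (R : realType) (f : R -> R) (M e : R) :
  continuous f -> 0 < e -> exists2 d : R, 0 < d &
    forall x y, `|x| <= M -> `|x - y| <= d -> `|f x - f y| <= e.
Proof.
move=> cf e0.
have /compact_near_coveringP cK := @segment_compact R (- M) M.
have := cK _ (0 : R)^'+ (fun d x => forall y, `|x - y| <= d -> `|f x - f y| <= e).
case.
  move=> x _.
  have e20 : 0 < e / 2 by rewrite divr_gt0.
  have /cvgrPdist_le/(_ _ e20) := cf x.
  move=> /nbhs_ballP[r /= r0 fr].
  (* Half of [r] is spent on [x'] and half on [d], so [x'] and [y] both lie in [ball x r], where [f]
     is within [e / 2] of [f x]. *)
  exists (ball x (r / 2), [set d | d < r / 2]) => /=.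
    split; first by apply: nbhsx_ballx; rewrite divr_gt0.
    by apply: nbhs_right_lt; rewrite divr_gt0.
  move=> [x' d] /= [xx' dr] y x'y.
  have f1 := fr x'; have f2 := fr y.
  have xy : ball x r y.
    rewrite /ball/= in xx' *.
    have := ler_normD (x - x') (x' - y); rewrite addrA subrK; lra.
  have xx2 : ball x r x' by apply: le_ball xx'; rewrite ler_pdivrMr// ler_peMr ?ltW// ltr1n.
  have := f1 xx2; have := f2 xy; have := ler_distD (f x) (f x') (f y).
  rewrite (distrC (f x') (f x)); lra.
(* Compactness yields [r] such that every positive [d] below [r] works on the whole segment. *)
move=> r /= r0 /(_ (r / 2)) fr; exists (r / 2); first by rewrite divr_gt0.
move=> x y xM; apply: fr; rewrite ?divr_gt0//.
- rewrite /ball/= sub0r normrN gtr0_norm ?divr_gt0//; lra.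
- by rewrite /= in_itv/= -ler_norml.
Qed.

(** The essential supremum is itself an almost everywhere bound; the uniform continuity of [f] is
    applied to this pointwise form. *)
Lemma ess_norm_cvg0_near (R : realType) (w : nat -> Linfty R) (u : Linfty R)
    (d : R) : 0 < d ->
  'N[leb R]_+oo[EFin \o (w n \- u)%R]%E @[n --> \oo] --> 0%E ->
  \forall n \near \oo, \forall x \ae leb R, `|w n x - u x| <= d.
Proof.
move=> d0 wu.
have : \forall n \near \oo, ('N[leb R]_+oo[EFin \o (w n \- u)%R] < d%:E)%E.
  apply: (wu [set x | (x < d%:E)%E]); apply: open_nbhs_nbhs.
  by split; [exact: open_ereal_lt_ereal|rewrite /= lte_fin].
apply: filterS => n; rewrite unlock /Lnorm leb_setT_gt0 => /ltW wd.
apply: leb_aeS (ess_sup_ge (leb R) (abse \o (EFin \o (w n \- u)%R))) => x.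
by move=> /le_trans /(_ wd); rewrite /= lee_fin.
Qed.

Theorem proposition8p3 (R : realType) (f : R -> R)
    (hf : {homo f : x y / x <= y} \/ continuous f) (hf0 : f 0 = 0)
    (U : set_system R) (hU : lebesgue_ultrafilter U)
    (hUlr : right_filter U \/ left_filter U) :
  let mu : Linfty R -> R := fun u => Bulim U (Linfty_comp hf u) in
  [/\ Linfty_valuation mu, Linfty_translation_invariant mu,
      {homo f : x y / x <= y} -> Linfty_monotone mu &
      continuous f -> Linfty_continuous mu].

Proof.
move=> mu; split.
- split=> [u v|]; last first.
    apply: Bulim_eq0 => //.
    apply: leb_aeS (leb_aeI (Linfty_ofE (Lfun_comp (Linfty_zero R) hf))
      (Linfty_ofE (@Lfun_cst0 R))) => x [e1 e2].
    (* Here [f 0 = 0] enters. *)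
    by rewrite [LHS]e1 /= [Linfty_fun _ _]e2.
  suff : mu (Linfty_max u v) - mu u = mu v - mu (Linfty_min u v) by lra.
  apply: Bulim_subr => //.
  have E w := Linfty_ofE (Lfun_comp w hf).
  apply: leb_aeS (leb_aeI (leb_aeI (E u) (E v)) (leb_aeI
    (leb_aeI (E (Linfty_max u v)) (E (Linfty_min u v)))
    (leb_aeI (Linfty_ofE (Lfun_max u v)) (Linfty_ofE (Lfun_min u v))))).
  move=> x [[eu ev] [[ea ei] [em en]]].
  have -> : Linfty_comp hf (Linfty_max u v) x = f (Num.max (u x) (v x)).
    by rewrite [LHS]ea /= [Linfty_fun _ _]em.
  have -> : Linfty_comp hf (Linfty_min u v) x = f (Num.min (u x) (v x)).
    by rewrite [LHS]ei /= [Linfty_fun _ _]en.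
  have -> : Linfty_comp hf u x = f (u x) by exact: eu.
  have -> : Linfty_comp hf v x = f (v x) by exact: ev.
  (* If [u x <= v x], both sides are [f (v x) - f (u x)]; otherwise both are 0. *)
  by case: (leP (u x) (v x)) => _; rewrite ?subrr.
- by move=> t u; rewrite /mu Linfty_comp_translate Bulim_translate.
- move=> ndf u v uv; apply: Bulim_le => //.
  apply: leb_aeS (leb_aeI uv (leb_aeI (Linfty_ofE (Lfun_comp u hf))
    (Linfty_ofE (Lfun_comp v hf)))) => x [uvx [e1 e2]].
  by rewrite [leLHS]e1 [leRHS]e2; exact: ndf.
- move=> cf w u wu; apply/cvgrPdist_le => e e0.
  have [M uM] := Linfty_ae_bounded_by u.
  (* [d] depends on [u] and [e] but not on [n]: only [u x] has to lie in the segment, while [w n x]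
     may leave it. *)
  have [d d0 fd] := continuous_segment_unif M cf e0.
  apply: filterS (ess_norm_cvg0_near d0 wu) => n wun.
  apply: Bulim_dist_le => //; first exact: ltW.
  apply: leb_aeS (leb_aeI (leb_aeI wun (proj2 uM)) (leb_aeI
    (Linfty_ofE (Lfun_comp u hf)) (Linfty_ofE (Lfun_comp (w n) hf)))).
  move=> x [[wux ux] [e1 e2]]; rewrite [Linfty_fun _ _]e1.
  rewrite [X in _ - X]e2; apply: fd => //.
  by rewrite distrC.
Qed.
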